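(* Let $W\in\mathbb{Z}$ with $W\neq 0$ and let $\alpha\in\mathbb{R}$. Let $\Theta_1,\Theta_2$ be independent random variables, each uniformly distributed on $(-\pi,\pi]$, and set $\Phi_i:=\alpha+W\,\Theta_i \pmod{2\pi}$ for $i=1,2$. Then the weighted toroidal Kendall coefficient of the pair $(\Theta,\Phi)$, $$\tau_1=\frac{\mathbb{E}\big[\operatorname{wrap}_\pi(\Theta_2-\Theta_1)\,\mathrm{sign}\big(\operatorname{wrap}_\pi(\Phi_2-\Phi_1)\big)\big]}{\mathbb{E}\big[|\operatorname{wrap}_\pi(\Theta_2-\Theta_1)|\big]},$$ is well defined (the denominator is nonzero) and equals $$\tau_1=\frac{(-1)^{W+1}}{W}.$$ In particular $|\tau_1|=1/|W|$.
   Context: For $x\in\mathbb{R}$, the wrapped difference is $\operatorname{wrap}_\pi(x):=x-2\pi\left\lfloor\frac{x+\pi}{2\pi}\right\rfloor\in[-\pi,\pi)$; angles are interpreted modulo $2\pi$, so $\operatorname{wrap}_\pi(\Phi_2-\Phi_1)=\operatorname{wrap}_\pi(W(\Theta_2-\Theta_1))$. Here $\mathrm{sign}(y)=1$ for $y>0$, $-1$ for $y<0$, $0$ for $y=0$. In general, for a random pair $(\Theta,\Phi)$ of angles with i.i.d. copies $(\Theta_1,\Phi_1),(\Theta_2,\Phi_2)$, the weighted toroidal Kendall coefficient $\tau_1$ is defined by the displayed ratio, assuming the denominator is nonzero. *)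

(* Defs.v *)
From HB Require Import structures.
From mathcomp Require Import all_boot all_order all_algebra.
From mathcomp Require Import all_classical all_reals all_analysis.
Set Implicit Arguments. Unset Strict Implicit. Unset Printing Implicit Defensive.
Import Order.TTheory GRing.Theory Num.Theory.
Import numFieldNormedType.Exports.
Local Open Scope classical_set_scope.
Local Open Scope ring_scope.

Section Defs.
Variable R : realType.

(* wrap_pi x = x - 2 pi floor((x + pi) / (2 pi)), in [-pi, pi) *)
Definition wrap (x : R) : R :=
  x - 2 * pi * (Num.floor ((x + pi) / (2 * pi)))%:~R.

Lemma npi_lt_pi : - (pi : R) < pi.
Proof. by rewrite gtrN ?pi_gt0. Qed.

(* law of one angle: uniform on [-pi, pi] (= uniform on (-pi, pi] a.s.) *)
Definition unif : probability _ R := uniform_prob npi_lt_pi.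

Definition joint := (unif \x unif)%E.

(* Phi = alpha + W Theta (a real representative of the angle mod 2 pi) *)
Definition phi (alpha : R) (W : int) (t : R) : R := alpha + W%:~R * t.

Definition tau_num_f (alpha : R) (W : int) (z : R * R) : R :=
  wrap (z.2 - z.1) * Num.sg (wrap (phi alpha W z.2 - phi alpha W z.1)).

Definition tau_den_f (z : R * R) : R := `|wrap (z.2 - z.1)|.

Definition tau_num alpha W : \bar R := (\int[joint]_z (tau_num_f alpha W z)%:E)%E.
Definition tau_den : \bar R := (\int[joint]_z (tau_den_f z)%:E)%E.

Definition tau1 alpha W : R := fine (tau_num alpha W) / fine tau_den.

End Defs.

(* Main.v *)
Require Import Defs.
From HB Require Import structures.
From mathcomp Require Import all_boot all_order all_algebra.
From mathcomp Require Import all_classical all_reals all_analysis.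
From mathcomp Require Import measurable_realfun zify ring lra.
Import Order.TTheory GRing.Theory Num.Theory.
Import numFieldNormedType.Exports.
Local Open Scope classical_set_scope.
Local Open Scope ring_scope.

(** The numerator integrand depends only on t = Theta_2 - Theta_1, through the
    2 pi-periodic function g t = wrap t * sg (wrap (W t)); by Fubini and
    translation invariance its expectation is (2 pi)^-1 times the integral of g
    over [-pi, pi]. With n = |W|, on the open interval from k pi / n to
    (k + 1) pi / n one has g t = sg W * (-1)^k * t, and summing the pieces for
    -n <= k < n gives (-1)^(W + 1) pi^2 / W. The denominator integrand is the
    numerator integrand for W = 1, so its expectation is pi / 2. *)

Set Implicit Arguments.
Unset Strict Implicit.

(** * Wrapping modulo 2 pi: values, periodicity, measurability, sign *)

Lemma twopi_gt0 (R : realType) : 0 < 2 * pi :> R.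
Proof. by rewrite mulr_gt0 ?pi_gt0. Qed.

(** The floor is unique, so computing [wrap] only takes a [k] that lands in the range. *)
Lemma wrap_eq (R : realType) (k : int) (x : R) :
  - pi <= x - 2 * pi * k%:~R < pi -> Defs.wrap x = x - 2 * pi * k%:~R.
Proof.
move=> xk; rewrite /Defs.wrap (_ : Num.floor _ = k)//.
apply: floor_def; have P := twopi_gt0 R.
by rewrite ler_pdivlMr// ltr_pdivrMr// intrD; lra.
Qed.

Lemma wrap_itv (R : realType) (x : R) : - pi <= Defs.wrap x < pi.
Proof.
have P := twopi_gt0 R.
have := floor_itv ((x + pi) / (2 * pi)).
by rewrite ler_pdivlMr// ltr_pdivrMr// intrD /Defs.wrap; lra.
Qed.

Lemma wrap_id (R : realType) (x : R) : - pi <= x < pi -> Defs.wrap x = x.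
Proof. by move=> xpi; rewrite (@wrap_eq R 0) mulr0 subr0. Qed.

Lemma wrapD (R : realType) (k : int) (x : R) :
  Defs.wrap (x + 2 * pi * k%:~R) = Defs.wrap x.
Proof.
have xm := wrap_itv x; set m := Num.floor ((x + pi) / (2 * pi)).
have wE : Defs.wrap x = x - 2 * pi * m%:~R by [].
rewrite [RHS]wE (@wrap_eq R (m + k)) intrD; last by move: xm; rewrite wE; lra.
by ring.
Qed.

Lemma measurable_wrap (R : realType) : measurable_fun setT (@Defs.wrap R).
Proof.
have P := twopi_gt0 R.
apply: measurable_funB => //; apply: measurable_funM => //.
apply: nondecreasing_measurable => // x y xy.
rewrite ler_int le_floor// ler_pM2r ?invr_gt0//; lra.
Qed.

Lemma measurable_sgr (R : realType) : measurable_fun setT (@Num.sg R).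
Proof.
apply: nondecreasing_measurable => // x y xy.
by case: (sgrP x) => ?; case: (sgrP y) => ? //; lra.
Qed.

(** Parity of [m] decides: for [m = 2 * k], removing [k] turns leaves a point of (0, pi); for
    [m = 2 * k + 1], removing [k + 1] turns leaves a point of (-pi, 0). *)
Lemma sg_wrap (R : realType) (m : int) (y : R) :
  m%:~R * pi < y < (m + 1)%:~R * pi -> Num.sg (Defs.wrap y) = (-1) ^ m.
Proof.
have P := pi_gt0 R.
have sqrN1 : (-1) ^ (2 : int) = 1 :> R by rewrite -exprnP sqrrN expr1n.
have [k [->|->]] : exists k : int, m = 2 * k \/ m = 2 * k + 1.
  exists (m %/ 2)%Z; have := modz_ge0 m (isT : (2 : int) != 0).
  by have := ltz_pmod m (isT : 0 < 2 :> int); have := divz_eq m 2; lia.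
- rewrite !(intrD, intrM) => H; rewrite (@wrap_eq R k); last lra.
  by rewrite gtr0_sg; [rewrite -exprz_exp sqrN1 exp1rz|lra].
- rewrite !(intrD, intrM) => H; rewrite (@wrap_eq R (k + 1)) ?intrD; last lra.
  by rewrite ltr0_sg; [rewrite exprzDr ?unitrN1// -exprz_exp sqrN1 exp1rz mul1r|lra].
Qed.

(** * Integrals of bounded measurable functions over intervals *)

Definition bounded_mfun d (T : measurableType d) (R : realType) (f : T -> R) :=
  measurable_fun setT f /\ exists M, forall x, `|f x| <= M.

Lemma bounded_mfun_integrable d (T : measurableType d) (R : realType)
    (mu : {measure set T -> \bar R}) (f : T -> R) (A : set T) :
  bounded_mfun f -> measurable A -> (mu A < +oo)%E -> mu.-integrable A (EFin \o f).
Proof.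
move=> [mf [M fM]] mA Aoo; apply: measurable_bounded_integrable => //.
  exact: measurable_funTS.
exists M; split; first exact: num_real.
by move=> N MN x _; exact: le_trans (fM x) (ltW MN).
Qed.

Lemma bounded_mfun_integrable_itv (R : realType) (f : R -> R) (b0 b1 : bool) (a b : R) :
  bounded_mfun f ->
  lebesgue_measure.-integrable [set` Interval (BSide b0 a) (BSide b1 b)] (EFin \o f).
Proof.
move=> bf; apply: bounded_mfun_integrable => //.
by rewrite /= lebesgue_measure_itv/=; case: ifP => // _; rewrite -EFinB ltry.
Qed.

Lemma Rintegral_itv_cat (R : realType) (f : R -> R) (a b c : R) :
  bounded_mfun f -> a <= b -> b <= c ->
  \int[lebesgue_measure]_(x in `[a, c]) f x =
  \int[lebesgue_measure]_(x in `[a, b]) f x +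
  \int[lebesgue_measure]_(x in `[b, c]) f x.
Proof.
(* Opening the second interval at [b] costs nothing and makes the two pieces disjoint. *)
move=> bf ab bc; rewrite -[in X in _ + X]Rintegral_itv_obnd_cbnd; last first.
  exact: bounded_mfun_integrable_itv.
rewrite -(@Rintegral_itvB _ _ (BLeft a))//; first by rewrite addrC subrK.
exact: bounded_mfun_integrable_itv.
Qed.

(** Lebesgue measure is determined by its values on half-open intervals, and a translation keeps
    their length. *)
Lemma lebesgue_measure_shift (R : realType) (c : R) (A : set R) : measurable A ->
  pushforward lebesgue_measure (fun x : R => x - c : measurableTypeR R) A =
  lebesgue_measure A.
Proof.
pose phi (x : R) : measurableTypeR R := x - c.
have mphi : measurable_fun setT phi by exact: measurable_funB.
move=> mA; apply/esym.
apply: (@lebesgue_measure_unique _ (pushforward lebesgue_measure phi)) => //.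
move=> _ [[a b]] _ <-.
rewrite /= /pushforward (_ : phi @^-1` _ = `]a + c, b + c]%classic); last first.
  by apply/seteqP; split => x /=; rewrite !in_itv/= /phi; lra.
rewrite /= !lebesgue_measure_itv/= !lte_fin ltrD2r.
by case: ifP => // _; rewrite -!EFinB; congr EFin; ring.
Qed.

Lemma Rintegral_shift (R : realType) (f : R -> R) (a b c : R) : bounded_mfun f ->
  \int[lebesgue_measure]_(x in `[a, b]) f (x - c) =
  \int[lebesgue_measure]_(x in `[a - c, b - c]) f x.
Proof.
move=> bf; have [mf [M fM]] := bf.
pose phi (x : R) : measurableTypeR R := x - c.
have mphi : measurable_fun setT phi by exact: measurable_funB.
have bfc : bounded_mfun (fun x : R => f (x - c)).
  by split; [exact: measurableT_comp mf mphi|exists M => x].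
have abE : phi @^-1` `[a - c, b - c] = `[a, b]%classic.
  by apply/seteqP; split => x /=; rewrite !in_itv/= /phi; lra.
rewrite /Rintegral; congr fine.
transitivity (\int[pushforward lebesgue_measure phi]_(x in `[(a - c)%R, (b - c)%R])
    (f x)%:E)%E.
  rewrite integral_pushforward//= ?abE//.
  - exact/measurable_EFinP.
  - exact: bounded_mfun_integrable_itv.
by apply: eq_measure_integral => //= A mA _; exact: lebesgue_measure_shift.
Qed.

(** A shift by a multiple of [p] brings [a] into [-p, 0]; then the part over [a, 0] is moved by [p]
    onto [a + p, p]. *)
Lemma Rintegral_period (R : realType) (f : R -> R) (p a : R) : bounded_mfun f -> 0 < p ->
  (forall (k : int) x, f (x + p * k%:~R) = f x) ->
  \int[lebesgue_measure]_(x in `[a, a + p]) f x =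
  \int[lebesgue_measure]_(x in `[0, p]) f x.
Proof.
move=> bf p0 fp; have [k] : exists k : int, - p <= a - p * k%:~R <= 0.
  exists (Num.floor (a / p) + 1); have := floor_itv (a / p).
  by rewrite ler_pdivlMr// ltr_pdivrMr// intrD; lra.
have -> : \int[lebesgue_measure]_(x in `[a, a + p]) f x =
    \int[lebesgue_measure]_(x in `[a, a + p]) f (x - p * k%:~R).
  by apply: eq_Rintegral => x _; rewrite -[LHS](fp (- k)) intrN mulrN.
rewrite Rintegral_shift// addrAC; move: (a - _) => {}a {k} /andP[pa a0].
rewrite (@Rintegral_itv_cat _ _ a 0)//; last lra.
rewrite [RHS](@Rintegral_itv_cat _ _ 0 (a + p))//; [|lra|lra].
rewrite [LHS]addrC; congr (_ + _).
have -> : \int[lebesgue_measure]_(x in `[a, 0]) f x =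
          \int[lebesgue_measure]_(x in `[a, 0]) f (x - (- p)).
  by apply: eq_Rintegral => x _; rewrite opprK -[LHS](fp 1) mulr1.
by rewrite Rintegral_shift// opprK add0r.
Qed.

Lemma Rintegral_id (R : realType) (a b : R) : a <= b ->
  \int[lebesgue_measure]_(x in `[a, b]) x = (b ^+ 2 - a ^+ 2) / 2.
Proof.
rewrite le_eqVlt => /predU1P[->|ab].
  by rewrite set_itv1 Rintegral_set1 subrr mul0r.
have dF (x : R) : is_derive x (1 : R) (fun y : R => y ^+ 2 / 2) x.
  by apply: is_derive_eq; rewrite /GRing.scale/=; field.
have cF : continuous (fun y : R => y ^+ 2 / 2).
  by move=> x; apply/differentiable_continuous/derivable1_diffP; exact: ex_derive.
transitivity (fine ((b ^+ 2 / 2)%:E - (a ^+ 2 / 2)%:E)); last first.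
  by rewrite -EFinB/=; field.
congr fine; apply: (@continuous_FTC2 R id (fun y : R => y ^+ 2 / 2)) => //.
- by apply: continuous_subspaceT => x; exact: cvg_id.
- split => [x _||].
  + exact: ex_derive.
  + apply: cvg_at_right_filter; exact: cF.
  + apply: cvg_at_left_filter; exact: cF.
- by move=> x _; rewrite derive1E; exact: derive_val.
Qed.

(** Endpoints are null sets, so the formula for [f] is asked only in the open interval: the sign may
    take other values at the breakpoints. *)
Lemma Rintegral_linear (R : realType) (f : R -> R) (s a b : R) : bounded_mfun f ->
  a <= b -> (forall x, a < x < b -> f x = s * x) ->
  \int[lebesgue_measure]_(x in `[a, b]) f x = s * ((b ^+ 2 - a ^+ 2) / 2).
Proof.
move=> bf ab fs.
have -> : \int[lebesgue_measure]_(x in `[a, b]) f x =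
    \int[lebesgue_measure]_(x in `[a, b]) (s * x).
  congr fine; apply: eq_integral_itv_bounded.
  - by case: bf => mf _; exact: measurable_funTS.
  - exact: mulrl_measurable.
  - by move=> x; rewrite in_itv/=; exact: fs.
rewrite RintegralZl// ?Rintegral_id//.
apply: continuous_compact_integrable; first exact: segment_compact.
by apply: continuous_subspaceT => x; exact: cvg_id.
Qed.

(** The density formula is applied to the positive and negative parts separately; integrability lets
    the constant factor distribute over their difference. *)
Lemma integral_uniform_bounded_mfun (R : realType) (a b : R) (ab : a < b) (f : R -> R) :
  bounded_mfun f ->
  (\int[uniform_prob ab]_x (f x)%:E =
    ((b - a)^-1 * \int[lebesgue_measure]_(x in `[a, b]) f x)%:E)%E.
Proof.
move=> bf; have mf : measurable_fun setT (EFin \o f).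
  by case: bf => mf _; exact/measurable_EFinP.
have fint := bounded_mfun_integrable_itv true false a b bf.
rewrite EFinM fineK; last exact: integrable_fin_num.
rewrite [X in _ = (_ * X)%E](integralE lebesgue_measure) [LHS]integralE.
rewrite muleBr//; last exact: integrable_add_def fint.
congr (_ - _)%E; rewrite integral_uniform//.
- exact: measurable_funepos.
- exact: measurable_funeneg.
Qed.

(** * The integrand as a function of the angle difference *)

Definition wrap_sg (R : realType) (W : int) (t : R) : R :=
  Defs.wrap t * Num.sg (Defs.wrap (W%:~R * t)).

Lemma tau_num_fE (R : realType) (alpha : R) W (z : R * R) :
  tau_num_f alpha W z = wrap_sg W (z.2 - z.1).
Proof.
rewrite /tau_num_f /wrap_sg /phi; congr (_ * Num.sg (Defs.wrap _)); ring.
Qed.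

Lemma tau_den_fE (R : realType) (z : R * R) : tau_den_f z = tau_num_f 0 1 z.
Proof. by rewrite tau_num_fE /wrap_sg mul1r mulrC -normrEsg. Qed.

Lemma normr_wrap_sg (R : realType) W (t : R) : `|wrap_sg W t| <= pi.
Proof.
have tpi : `|Defs.wrap t| <= pi by rewrite ler_norml; have := wrap_itv t; lra.
by rewrite /wrap_sg normrM normr_sg (le_trans _ tpi)// ler_piMr//; case: eqP.
Qed.

Lemma measurable_wrap_sg (R : realType) W :
  measurable_fun setT (@wrap_sg R W).
Proof.
apply: measurable_funM; first exact: measurable_wrap.
apply: measurableT_comp; first exact: measurable_sgr.
apply: measurableT_comp; first exact: measurable_wrap.
exact: mulrl_measurable.
Qed.

Lemma bounded_mfun_wrap_sg (R : realType) W : bounded_mfun (@wrap_sg R W).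
Proof.
split; first exact: measurable_wrap_sg.
by exists pi => x; exact: normr_wrap_sg.
Qed.

(** As [W] is an integer, [k] turns of [t] become [W * k] full turns of [W%:~R * t]. *)
Lemma wrap_sg_periodic (R : realType) W (k : int) (t : R) :
  wrap_sg W (t + 2 * pi * k%:~R) = wrap_sg W t.
Proof.
rewrite /wrap_sg wrapD; congr (_ * Num.sg _).
by rewrite -[RHS](wrapD (W * k)) intrM; congr Defs.wrap; ring.
Qed.

(** The bounds on [k] keep [t] within (-pi, pi), where [wrap] is the identity. For [W > 0] the
    product [W t] lies between k pi and (k + 1) pi; for [W < 0] it lies between -(k + 1) pi and -k
    pi, whose opposite parity accounts for the sign of [W]. *)
Lemma wrap_sg_piece (R : realType) (W k : int) (t : R) : W != 0 ->
  - `|W| <= k < `|W| ->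
  k%:~R * (pi / `|W|%:~R) < t < (k + 1)%:~R * (pi / `|W|%:~R) ->
  wrap_sg W t = Num.sg W%:~R * (-1) ^ k * t.
Proof.
move=> W0 kW.
have n0 : 0 < `|W|%:~R :> R by rewrite ltr0z normr_gt0.
rewrite !mulrA ltr_pdivrMr// ltr_pdivlMr// => tk.
have [kn nk] : - (`|W|%:~R) <= k%:~R :> R /\ (k + 1)%:~R <= `|W|%:~R :> R.
  by rewrite -intrN !ler_int; lia.
have P := pi_gt0 R.
have -> : wrap_sg W t = t * Num.sg (Defs.wrap (W%:~R * t)).
  rewrite /wrap_sg wrap_id//.
  rewrite -(ler_pM2r n0) -(ltr_pM2r n0); nra.
rewrite mulrC; congr (_ * _).
have [Wp|Wn] := ltP 0 W.
  move: tk; rewrite gtr0_norm// (@gtr0_sg _ W%:~R) ?ltr0z// mul1r => tk.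
  by apply: sg_wrap; rewrite [W%:~R * t]mulrC.
have {}Wn : W < 0 by rewrite lt_neqAle W0.
move: tk; rewrite ltr0_norm// (@ltr0_sg _ W%:~R) ?ltrz0// intrN => tk.
rewrite (@sg_wrap _ (- (k + 1))); last first.
  rewrite !(intrD, intrN) in tk *; lra.
rewrite -exprz_inv invrN1 exprzDr ?unitrN1//; ring.
Qed.

Lemma Rintegral_wrap_sg (R : realType) (W : int) : W != 0 ->
  \int[lebesgue_measure]_(t in `[- pi, pi]) wrap_sg W t =
  (-1) ^ (W + 1) * pi ^+ 2 / W%:~R :> R.
Proof.
move=> W0; pose n := `|W|%N; pose h : R := pi / `|W|%:~R.
have P := pi_gt0 R.
have n0 : 0 < `|W|%:~R :> R by rewrite ltr0z normr_gt0.
have h0 : 0 < h by rewrite divr_gt0.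
have nh : `|W|%:~R * h = pi by rewrite mulrC divfK ?gt_eqF.
(* The pieces contribute multiples of (-1) ^ k * (2 * k + 1), which is the
   increment of k |-> - (-1) ^ k * k; hence the telescoped right-hand side. *)
have sumE (j : nat) : (j <= 2 * n)%N ->
    \int[lebesgue_measure]_(t in `[- pi, (j%:Z - `|W|)%:~R * h]) wrap_sg W t =
    Num.sg W%:~R * h ^+ 2 / 2 *
    ((-1) ^ (- `|W|) * (- `|W|)%:~R - (-1) ^ (j%:Z - `|W|) * (j%:Z - `|W|)%:~R) :> R.
  elim: j => [_|j IHj jn].
    by rewrite sub0r intrN mulNr nh set_itv1 Rintegral_set1 subrr mulr0.
  set k := j%:Z - `|W|; have -> : j.+1%:Z - `|W| = k + 1 by rewrite /k; lia.
  have kW : - `|W| <= k < `|W| by rewrite /k; lia.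
  rewrite (@Rintegral_itv_cat _ _ _ (k%:~R * h)); first last.
  - by rewrite ler_pM2r// ler_int; lia.
  - by rewrite -nh -mulNr ler_pM2r// -intrN ler_int; lia.
  - exact: bounded_mfun_wrap_sg.
  rewrite IHj ?(ltnW jn)// (Rintegral_linear (s := Num.sg W%:~R * (-1) ^ k)).
  - rewrite -/k; move: k kW => k kW.
    by rewrite (@exprzDr _ _ _ k) ?unitrN1// expr1z intrD; field.
  - exact: bounded_mfun_wrap_sg.
  - by rewrite ler_pM2r// ler_int; lia.
  - by move=> t; exact: wrap_sg_piece.
have := sumE (2 * n)%N (leqnn _).
have -> : (2 * n)%N%:Z - `|W| = `|W| by rewrite /n; lia.
rewrite nh => ->.
have m1E : (-1) ^ W = (-1) ^ `|W| :> R.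
  have [_|_] := ger0P W => //; by rewrite -exprz_inv invrN1.
rewrite exprzDr ?unitrN1// expr1z m1E -exprz_inv invrN1 /h.
(* The telescoped sum carries [h ^+ 2] times |W|, that is pi^2 / |W|; this form of the sign turns it
   into pi^2 / W. *)
have -> : Num.sg (W%:~R : R) = `|W|%:~R / W%:~R.
  by rewrite intr_norm normrEsg mulfK ?intr_eq0.
rewrite intrN; field.
by rewrite intr_eq0 W0; exact: lt0r_neq0 n0.
Qed.

(** * Expectations under the joint law *)

Lemma integral_joint_wrap_sg (R : realType) (alpha : R) (W : int) : W != 0 ->
  (@joint R).-integrable setT (fun z => (tau_num_f alpha W z)%:E) /\
  tau_num alpha W = ((-1) ^ (W + 1) * pi / (2 * W%:~R))%:E.
Proof.
move=> W0; have P := pi_gt0 R.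
have -> : tau_num_f alpha W = fun z => wrap_sg W (z.2 - z.1).
  by apply/funext => z; rewrite tau_num_fE.
(* Fubini requires this; it holds since the integrand is bounded by pi and the joint law has mass
   1. *)
have int : (@joint R).-integrable setT (fun z => (wrap_sg W (z.2 - z.1))%:E).
  apply: bounded_mfun_integrable => //=.
  - split; last by exists pi => z; exact: normr_wrap_sg.
    apply: measurableT_comp; first exact: measurable_wrap_sg.
    exact: measurable_funB.
  - rewrite /= /joint -setXTT product_measure1E//.
    by rewrite -[X in (X * _)%E]/(unif R setT) -[X in (_ * X)%E]/(unif R setT)
      probability_setT mule1 ltry.
split => //.
rewrite /tau_num.
have -> : tau_num_f alpha W = fun z => wrap_sg W (z.2 - z.1).
  by apply/funext => z; rewrite tau_num_fE.
rewrite /joint -integral12_prod_meas1//= /fubini_F.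
(* The inner integral does not depend on the first angle [x], since it runs over a full period. *)
transitivity (\int[unif R]_x (((-1) ^ (W + 1) * pi / (2 * W%:~R))%:E : \bar R))%E; last first.
  by rewrite integral_cst//= probability_setT mule1.
apply: eq_integral => x _.
have bg := bounded_mfun_wrap_sg R W.
have bgx : bounded_mfun (fun t : R => wrap_sg W (t - x)).
  split; last by exists pi => t; exact: normr_wrap_sg.
  apply: measurableT_comp; first exact: measurable_wrap_sg.
  exact: measurable_funB.
rewrite integral_uniform_bounded_mfun// Rintegral_shift//.
have periodE a := @Rintegral_period _ _ _ a bg (twopi_gt0 R) (@wrap_sg_periodic R W).
have -> : pi - x = - pi - x + 2 * pi by ring.
(* The period starting at -pi - x is exchanged for [-pi, pi] by passing through [0, 2 pi]. *)
rewrite periodE -(periodE (- pi)) (_ : - pi + 2 * pi = pi); last by ring.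
rewrite Rintegral_wrap_sg//; congr EFin; move: (pi : R) P => q q0; field.
by rewrite intr_eq0 W0 gt_eqF//; lra.
Qed.

Unset Implicit Arguments.
Set Strict Implicit.

(** Integrability makes both expectations finite, so [fine] never returns a default value in [tau1];
    with the nonzero denominator, the quotient is a genuine one. *)
Theorem theorem1 (R : realType) (W : int) (alpha : R) (hW : W != 0) :
  [/\ (@joint R).-integrable setT (fun z => (tau_num_f alpha W z)%:E),
      (@joint R).-integrable setT (fun z => (tau_den_f z)%:E),
      @tau_den R != 0%E &
      tau1 alpha W = (-1) ^ (W + 1) / W%:~R].
Proof.
have denE : @tau_den_f R = tau_num_f 0 1 by apply/funext => z; rewrite tau_den_fE.
have [inum numE] := integral_joint_wrap_sg alpha hW.
have [iden denvalE] := @integral_joint_wrap_sg R 0 1 isT.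
have tau_denE : @tau_den R = (pi / 2)%:E.
  by rewrite /tau_den denE -/(tau_num 0 1) denvalE; congr EFin; field.
have P := pi_gt0 R.
split => //.
- by rewrite denE.
- by rewrite tau_denE eqe gt_eqF// divr_gt0.
- rewrite /tau1 numE tau_denE /=; move: (pi : R) P => q q0; field.
  by rewrite intr_eq0 hW gt_eqF.
Qed.
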